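(* Let $1\le k<n$, let $\Delta\subset\mathbb{C}$ be the unit disc, and let $u$ be a plurisubharmonic function on $\Delta^n$ with $u\leq 0$. Write $z=(z',z'')$ with $z'\in\Delta^k$, $z''\in\Delta^{n-k}$. Then the function $\phi_u$ on $\Delta^k$ is constant.
   Context: For $u$ plurisubharmonic and $\leq 0$ on $\Delta^n$, define $\phi_u(z')=\left(-\nu_u(z',\cdot)(0)\right)^*$ for $z'\in\Delta^k$, where $\nu_u(z',\cdot)(0)$ is the Lelong number at $0\in\Delta^{n-k}$ of the function $z''\mapsto u(z',z'')$, and ${}^*$ denotes the upper semicontinuous regularization on $\Delta^k$. *)

(* Defs.v *)
From HB Require Import structures.
From mathcomp Require Import all_boot all_order all_algebra.
From mathcomp Require Import all_classical all_reals all_analysis.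
From mathcomp Require Import complex.

Set Implicit Arguments.
Unset Strict Implicit.
Unset Printing Implicit Defensive.

Import Order.TTheory GRing.Theory Num.Theory.
Local Open Scope classical_set_scope.
Local Open Scope ring_scope.

Section PSH.
Variable R : realType.

Definition Cn (n : nat) := 'rV[R[i]]_n.

Definition absC (z : R[i]) : R := Num.sqrt (complex.Re z ^+ 2 + complex.Im z ^+ 2).

Definition eucl (n : nat) (z : Cn n) : R :=
  Num.sqrt (\sum_(j < n) absC (z ord0 j) ^+ 2).
Definition cdist (n : nat) (z w : Cn n) : R := eucl (z - w).

Definition polydisc (n : nat) : set (Cn n) :=
  [set z | forall j : 'I_n, absC (z ord0 j) < 1].

Definition expi (t : R) : R[i] := @complex.Complex R (cos t) (sin t).

Definition usc_on (n : nat) (D : set (Cn n)) (u : Cn n -> \bar R) : Prop :=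
  forall a, D a -> forall c : R, (u a < c%:E)%E ->
    exists2 d : R, 0 < d & forall w, D w -> cdist w a < d -> (u w < c%:E)%E.

(* plurisubharmonic functions on the polydisc Delta^n
   (Hormander/Demailly definition: usc, values in [-oo,+oo), not identically
   -oo, and sub-mean value inequality on every closed analytic disc
   {a + zeta b : |zeta| <= 1} contained in Delta^n) *)
Definition psh_polydisc (n : nat) (u : Cn n -> \bar R) : Prop :=
  [/\ forall z, polydisc z -> (u z < +oo)%E,
      usc_on (@polydisc n) u,
      (exists z, polydisc z /\ u z <> -oo%E) &
      forall a b : Cn n,
        (forall zeta : R[i], absC zeta <= 1 -> polydisc (a + zeta *: b)) ->
        (u a <= ((2 * pi)^-1)%:E *
           \int[@lebesgue_measure R]_(t in `[0%R, (2 * pi)%R]%classic)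
               u (a + expi t *: b)%R)%E ].

Definition supball (m : nat) (v : Cn m -> \bar R) (r : R) : \bar R :=
  ereal_sup [set v w | w in [set w : Cn m | eucl w < r]].

Definition lelong0 (m : nat) (v : Cn m -> \bar R) : \bar R :=
  lim ((fun r : R => (supball v r * ((ln r)^-1)%:E)%E) @ (0:R)^'+).

Definition usc_reg (n : nat) (D : set (Cn n)) (f : Cn n -> \bar R) (a : Cn n)
  : \bar R :=
  ereal_inf [set ereal_sup [set f w | w in [set w | D w /\ cdist w a < d]]
            | d in [set d : R | 0 < d]].

Definition phi_u (k m : nat) (u : Cn (k + m) -> \bar R) : Cn k -> \bar R :=
  usc_reg (@polydisc k)
    (fun z' : Cn k => (- lelong0 (fun z'' : Cn m => u (row_mx z' z'')))%E).

End PSH.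

(* Main.v *)
Require Import Defs.
From HB Require Import structures.
From mathcomp Require Import all_boot all_order all_algebra.
From mathcomp Require Import all_classical all_reals all_analysis.
From mathcomp Require Import complex.
From mathcomp Require Import ring lra.

(* Let M(z', r) be the supremum of u(z', .) on the ball of radius r; M(z', r) /
   ln r increases with r, so the Lelong number nu(z') is its infimum.  If
   nu >= A near p, then u(q, w) <= A ln |w| for q near p, and along the curve
   zeta |-> (p + zeta d, zeta^N w) the function u is bounded by A N ln |zeta|
   near zeta = 0 and by 0 on |zeta| = 1.  By the maximum principle
   u(p + xi d, xi^N w) <= A ln (xi^N) for every N, i.e. nu(p + xi d) >= A with
   no loss in A.  Hence phi_u(p) >= - nu(a) for all a in a polydisc centred at
   p, and phi_u is locally constant, with uniform radii along segments.

   Since the sub-mean value property is only given for affine discs, the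
   maximum principle along the (non-affine) curve is proved on a neighbourhood
   of it, with a barrier penalizing the squared distance to the curve: on the
   affine disc tangent to the curve this square is superharmonic up to third
   order, which a small multiple of 1 - |zeta|^2 absorbs. *)

Set Implicit Arguments.
Unset Strict Implicit.
Unset Printing Implicit Defensive.

Import Order.TTheory GRing.Theory Num.Theory.
Import numFieldNormedType.Exports.

Local Open Scope classical_set_scope.
Local Open Scope ring_scope.

(** * Modulus on the complex plane and Euclidean norm on its powers *)

Section ModulusAndEuclideanNorm.
Context {R : realType}.
Implicit Types (z w tau : R[i]).

Lemma sqr_absC z : absC z ^+ 2 = complex.Re z ^+ 2 + complex.Im z ^+ 2.
Proof. by rewrite /absC sqr_sqrtr// addr_ge0// sqr_ge0. Qed.

Lemma absC_ge0 z : 0 <= absC z.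
Proof. exact: sqrtr_ge0. Qed.

Lemma absC_normc z : absC z = Normc.normc z.
Proof. by case: z. Qed.

Lemma absC0 : absC (0 : R[i]) = 0.
Proof. by rewrite /absC /= expr0n addr0 sqrtr0. Qed.

Lemma absCM z w : absC (z * w) = absC z * absC w.
Proof. by rewrite !absC_normc Normc.normcM. Qed.

Lemma absCX z n : absC (z ^+ n) = absC z ^+ n.
Proof.
elim: n => [|n IHn]; last by rewrite !exprS absCM IHn.
by rewrite !expr0 absC_normc Normc.normc1.
Qed.

Lemma absCD z w : absC (z + w) <= absC z + absC w.
Proof. by rewrite !absC_normc; exact: le_normcD. Qed.

Lemma absCN z : absC (- z) = absC z.
Proof. by rewrite /absC; case: z => a b /=; rewrite !sqrrN. Qed.

Lemma absC_real (x : R) : absC x%:C%C = `|x|.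
Proof. by rewrite /absC /= expr0n addr0 sqrtr_sqr. Qed.

Lemma absC_expi (t : R) : absC (expi t) = 1.
Proof. by rewrite /absC /= cos2Dsin2 sqrtr1. Qed.

Lemma normr_Re_le z : `|complex.Re z| <= absC z.
Proof. by rewrite -sqrtr_sqr ler_wsqrtr// lerDl sqr_ge0. Qed.

Lemma normr_Im_le z : `|complex.Im z| <= absC z.
Proof. by rewrite -sqrtr_sqr ler_wsqrtr// lerDr sqr_ge0. Qed.

Section Eucl.
Context {n : nat}.
Implicit Types (a b : Cn R n).

Lemma sqr_eucl a : eucl a ^+ 2 = \sum_(j < n) absC (a ord0 j) ^+ 2.
Proof. by rewrite /eucl sqr_sqrtr// sumr_ge0// => j _; rewrite sqr_ge0. Qed.

Lemma eucl_ge0 a : 0 <= eucl a.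
Proof. exact: sqrtr_ge0. Qed.

Lemma absC_le_eucl a j : absC (a ord0 j) <= eucl a.
Proof.
rewrite -(ler_pXn2r (n := 2))// ?nnegrE ?absC_ge0 ?eucl_ge0// sqr_eucl.
by rewrite (bigD1 j)//= lerDl sumr_ge0// => i _; rewrite sqr_ge0.
Qed.

Lemma euclZ z a : eucl (z *: a) = absC z * eucl a.
Proof.
apply/eqP; rewrite -(eqrXn2 (n := 2))// ?mulr_ge0 ?absC_ge0 ?eucl_ge0//.
rewrite exprMn !sqr_eucl mulr_sumr; apply/eqP/eq_bigr => j _.
by rewrite mxE absCM exprMn.
Qed.

(** Young's inequality with weight [s]: in each real coordinate the difference of the two sides is
    [s^-1 * (s * c - d) ^+ 2]. *)
Lemma sqr_euclD_le a b (s : R) : 0 < s ->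
  eucl (a + b) ^+ 2 <= (1 + s) * eucl a ^+ 2 + (1 + s^-1) * eucl b ^+ 2.
Proof.
move=> s0; rewrite !sqr_eucl !mulr_sumr -big_split/=; apply: ler_sum => j _.
rewrite mxE !sqr_absC; case: (a ord0 j) => x y; case: (b ord0 j) => x' y' /=.
have s1 : s * s^-1 = 1 by rewrite mulfV// gt_eqF.
have si : 0 < s^-1 by rewrite invr_gt0.
have sq (c d : R) : (c + d) ^+ 2 <= (1 + s) * c ^+ 2 + (1 + s^-1) * d ^+ 2.
  rewrite -subr_ge0.
  have -> : (1 + s) * c ^+ 2 + (1 + s^-1) * d ^+ 2 - (c + d) ^+ 2
    = s^-1 * (s * c - d) ^+ 2.
    have -> : s^-1 * (s * c - d) ^+ 2 =
      (s * s^-1) * s * c ^+ 2 - 2 * (s * s^-1) * c * d + s^-1 * d ^+ 2 by ring.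
    by rewrite s1; ring.
  by rewrite mulr_ge0 ?sqr_ge0 ?(ltW si).
by have := lerD (sq x x') (sq y y'); lra.
Qed.

Lemma euclD a b : eucl (a + b) <= eucl a + eucl b.
Proof.
have ha := eucl_ge0 a; have hb := eucl_ge0 b.
apply/ler_addgt0Pr => e e0.
(* The slack [e / 2] makes both numbers positive, so that the weight [B / A] exists; with this
   weight Young's bound for [A] and [B] is exactly [(A + B) ^+ 2]. *)
set A := eucl a + e / 2; set B := eucl b + e / 2.
have A0 : 0 < A by rewrite /A; lra.
have B0 : 0 < B by rewrite /B; lra.
have -> : eucl a + eucl b + e = A + B by rewrite /A /B; lra.
rewrite -(ler_pXn2r (n := 2))// ?nnegrE ?eucl_ge0//; last lra.
apply: le_trans (sqr_euclD_le a b (divr_gt0 B0 A0)) _.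
have -> : (A + B) ^+ 2 = (1 + B / A) * A ^+ 2 + (1 + (B / A)^-1) * B ^+ 2.
  by field; lra.
apply: lerD; rewrite ler_pM2l ?ler_pXn2r ?nnegrE//; rewrite ?/A ?/B; try lra.
  by rewrite addr_gt0// divr_gt0.
by rewrite addr_gt0// invr_gt0 divr_gt0.
Qed.

End Eucl.
End ModulusAndEuclideanNorm.

(* The integral of a nonnegative function is a supremum over simple functions
   below it, so no measurability is needed here. *)
Lemma le_integral_nonmeasurable d (T : measurableType d) (R : realType)
    (mu : {measure set T -> \bar R}) (D : set T) (f g : T -> \bar R) :
  (forall x, D x -> (f x <= g x)%E) ->
  (\int[mu]_(x in D) f x <= \int[mu]_(x in D) g x)%E.
Proof.
move=> fg.
have fgD x : ((f \_ D) x <= (g \_ D) x)%E.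
  by rewrite /patch; case: ifPn => // /set_mem /fg.
rewrite /integral; apply: leeB; apply: le_ereal_sup => _ [h /= hle <-];
  exists h => // x; apply: le_trans (hle x) _; rewrite ?funeposE ?funenegE
    ge_max !le_max ?leeN2 fgD lexx ?orbT //.
Qed.

(** * Circular means of harmonic polynomials of degree at most two *)

Section Trigonometric.
Context {R : realType}.

(* The real parts of [(a - i b) tau + (c - i d) tau ^ 2]. *)
Definition harm2 (a b c d : R) (tau : R[i]) : R :=
  a * complex.Re tau + b * complex.Im tau
  + c * (complex.Re tau ^+ 2 - complex.Im tau ^+ 2)
  + d * (2 * complex.Re tau * complex.Im tau).

Lemma integral_harm2 (c0 a b c d : R) :
  (\int[@lebesgue_measure R]_(t in `[0%R, (2 * pi)%R]%classic)
     (c0 + harm2 a b c d (expi t))%:E = (2 * pi * c0)%:E)%E.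
Proof.
pose F : R -> R := fun t => c0 * t + a * sin t - b * cos t
  + c * (sin t * cos t) + d * (sin t) ^+ 2.
have dF (t : R) : is_derive t 1 F (c0 + harm2 a b c d (expi t)).
  rewrite /F /harm2 /=; apply: is_derive_eq.
  rewrite /GRing.scale /=; ring.
have cF : continuous F.
  move=> t; apply: differentiable_continuous; apply/derivable1_diffP.
  exact: ex_derive.
have p0 : 0 < 2 * pi :> R by rewrite mulr_gt0// pi_gt0.
rewrite (@continuous_FTC2 _ _ F)//.
- rewrite /F; have := @sin2pi R; have := @cos2pi R; rewrite !mulr_natl => -> ->.
  rewrite sin0 cos0 -EFinB; congr EFin; ring.
- apply: continuous_subspaceT => t.
  rewrite /harm2 /=.
  apply: differentiable_continuous; apply/derivable1_diffP.
  exact: ex_derive.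
- split.
  + by move=> x _; exact: ex_derive.
  + by apply: cvg_at_right_filter; exact: cF.
  + by apply: cvg_at_left_filter; exact: cF.
- by move=> x _; rewrite derive1E; exact: derive_val.
Qed.

(** The frequencies 1 and 2 integrate to zero over a period, which leaves [c0]. The radius [rho] is
    absorbed into the four coefficients. *)
Lemma circle_mean_le (f : R -> \bar R) (c0 a b c d rho : R) :
  (forall t, (f t <= (c0 + harm2 a b c d (rho%:C%C * expi t))%:E)%E) ->
  (((2 * pi)^-1)%:E * \int[@lebesgue_measure R]_(t in `[0%R, (2 * pi)%R]%classic)
      f t <= c0%:E)%E.
Proof.
move=> fle.
have p0 : 0 < 2 * pi :> R by rewrite mulr_gt0// pi_gt0.
have -> : c0%:E = (((2 * pi)^-1)%:E * (2 * pi * c0)%:E)%E.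
  by rewrite -EFinM mulKf// gt_eqF.
rewrite lee_pmul2l ?lte_fin ?invr_gt0//.
rewrite -(integral_harm2 c0 (rho * a) (rho * b) (rho ^+ 2 * c) (rho ^+ 2 * d)).
apply: le_integral_nonmeasurable => t _; apply: le_trans (fle t) _.
rewrite lee_fin le_eqVlt; apply/orP; left; apply/eqP.
by rewrite /harm2 /=; ring.
Qed.

End Trigonometric.

(** * Third-order superharmonicity of the terms of the barrier *)

Section Superharmonicity.
Context {R : realType}.
Implicit Types (tau zeta : R[i]).

(* [f] is superharmonic at [0] up to third order, with excess [kap]: the
   harmonic polynomial in the bound has circular mean zero. *)
Definition superharmonic2 (rho C kap : R) (f : R[i] -> R) : Prop :=
  exists a b c d : R, forall tau, absC tau <= rho ->
    f tau <= f 0 + harm2 a b c d tau - kap * absC tau ^+ 2 + C * absC tau ^+ 3.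

Lemma superharmonic2D rho C1 C2 kap1 kap2 f g :
  superharmonic2 rho C1 kap1 f -> superharmonic2 rho C2 kap2 g ->
  superharmonic2 rho (C1 + C2) (kap1 + kap2) (fun tau => f tau + g tau).
Proof.
move=> [a [b [c [d Hf]]]] [a' [b' [c' [d' Hg]]]].
exists (a + a'), (b + b'), (c + c'), (d + d') => tau ht.
apply: le_trans (lerD (Hf _ ht) (Hg _ ht)) _.
by rewrite /harm2; lra.
Qed.

Lemma superharmonic2Z rho C kap k f : 0 <= k ->
  superharmonic2 rho C kap f ->
  superharmonic2 rho (k * C) (k * kap) (fun tau => k * f tau).
Proof.
move=> k0 [a [b [c [d Hf]]]].
exists (k * a), (k * b), (k * c), (k * d) => tau ht.
apply: le_trans (ler_wpM2l k0 (Hf _ ht)) _.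
by rewrite /harm2; lra.
Qed.

Lemma superharmonic2_weak rho rho' C C' kap f : rho' <= rho -> C <= C' ->
  superharmonic2 rho C kap f -> superharmonic2 rho' C' kap f.
Proof.
move=> hr hC [a [b [c [d Hf]]]]; exists a, b, c, d => tau ht.
apply: le_trans (Hf _ (le_trans ht hr)) _; rewrite lerD2l ler_wpM2r//.
by rewrite exprn_ge0// absC_ge0.
Qed.

Lemma superharmonic2_sqr_absC rho k zeta :
  superharmonic2 rho 0 1 (fun tau => k - absC (zeta + tau) ^+ 2).
Proof.
exists (- 2 * complex.Re zeta), (- 2 * complex.Im zeta), 0, 0 => tau _.
rewrite addr0 !sqr_absC /harm2; case: zeta => x y; case: tau => s t /=.
by rewrite le_eqVlt; apply/orP; left; apply/eqP; ring.
Qed.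

(** The right side minus the left has derivative [x ^+ 3 / (1 + x)], which has the sign of [x], so
    its minimum is the value 0 at [x = 0]. *)
Lemma ln1D_le_cubic (y : R) : -1 < y ->
  ln (1 + y) <= y - y ^+ 2 / 2 + y ^+ 3 / 3.
Proof.
move=> y1.
pose f (x : R) : R := x - x ^+ 2 / 2 + x ^+ 3 / 3 - ln (1 + x).
pose df (x : R) : R := x ^+ 3 / (1 + x).
have fd (x : R) : -1 < x -> is_derive x 1 f (df x).
  move=> x1; have x10 : 0 < 1 + x by lra.
  rewrite /f; have dln : is_derive x 1 (fun z : R => ln (1 + z)) (1 + x)^-1.
    have h := is_derive1_ln x10.
    have hx : is_derive x 1 (fun z : R => 1 + z) 1.
      by apply: is_derive_eq; rewrite add0r mulr1.
    by have := is_derive1_comp h hx; rewrite mulr1.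
  apply: is_derive_eq; rewrite /df /GRing.scale/=; field; lra.
have fc (a b : R) : -1 < a -> {within `[a, b], continuous f}.
  move=> a1; apply: continuous_in_subspaceT => x.
  rewrite inE/= in_itv/= => /andP[ax _].
  apply: differentiable_continuous; apply/derivable1_diffP.
  by case: (fd x (lt_le_trans a1 ax)).
have f0 : f 0 = 0 by rewrite /f addr0 ln1 !expr0n/= !mul0r; ring.
suff : 0 <= f y by rewrite /f subr_ge0.
have [y0|y0] := leP 0 y.
  have [||c] := @MVT_segment R f df 0 y y0; [|by apply: fc; lra|].
    by move=> x; rewrite in_itv/= => /andP[x0 _]; apply: fd; lra.
  rewrite in_itv/= => /andP[c0 _]; rewrite f0 !subr0 => ->.
  by rewrite mulr_ge0// /df divr_ge0 ?exprn_ge0//; lra.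
have [||c] := @MVT_segment R f df y 0 (ltW y0); [|exact: fc|].
  by move=> x; rewrite in_itv/= => /andP[x0 _]; apply: fd; lra.
rewrite in_itv/= => /andP[yc c0]; rewrite f0 !sub0r => h.
have -> : f y = - df c * - y.
  by apply: (@oppr_inj R); rewrite h; ring.
rewrite mulr_ge0 ?oppr_ge0 ?(ltW y0)// /df -oppr_ge0 -mulNr divr_ge0//; last lra.
by rewrite exprS mulrC -mulrN mulr_ge0 ?sqr_ge0// oppr_ge0.
Qed.

(* For [v = Re sigma] and [k = |sigma|], this is the expansion of
   [ln |1 + sigma| ^ 2], since [k ^+ 2 - 2 * v ^+ 2 = - Re (sigma ^ 2)]. *)
Lemma ln_taylor2 (v k : R) : 0 <= k -> k <= 1 -> `|v| <= k ->
  0 < 1 + (2 * v + k ^+ 2) ->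
  ln (1 + (2 * v + k ^+ 2)) <= 2 * v + k ^+ 2 - 2 * v ^+ 2 + 12 * k ^+ 3.
Proof.
move=> k0 k1; rewrite ler_norml => /andP[vl vu] Y0.
apply: le_trans (ln1D_le_cubic (y := 2 * v + k ^+ 2) _) _; first lra.
have k2 : 0 <= k ^+ 2 by rewrite sqr_ge0.
have k2k : k ^+ 2 <= k by rewrite expr2 ler_piMr.
have vk2 : - v * k ^+ 2 <= k ^+ 3 by rewrite exprS ler_wpM2r//; lra.
have k4 : 0 <= (k ^+ 2) ^+ 2 by rewrite sqr_ge0.
have Y3 : (2 * v + k ^+ 2) ^+ 3 <= 27 * k ^+ 3.
  have -> : 27 * k ^+ 3 = (3 * k) ^+ 3 by ring.
  have [Yp|/ltW Yn] := leP 0 (2 * v + k ^+ 2).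
    by rewrite ler_pXn2r ?nnegrE//; lra.
  apply: (@le_trans _ _ 0); last by rewrite exprn_ge0// mulr_ge0.
  by rewrite exprS mulr_le0_ge0// sqr_ge0.
have k3 : 0 <= k ^+ 3 by rewrite exprn_ge0.
(* The cross term costs at most [2 * k ^+ 3] and the cubic term [27 * k ^+ 3 / 3], together below
   [12 * k ^+ 3]. *)
have -> : (2 * v + k ^+ 2) - (2 * v + k ^+ 2) ^+ 2 / 2 = 2 * v + k ^+ 2
  - 2 * v ^+ 2 + 2 * (- v * k ^+ 2) - (k ^+ 2) ^+ 2 / 2 by field.
move: ((2 * v + k ^+ 2) ^+ 3) ((k ^+ 2) ^+ 2) (- v * k ^+ 2) (k ^+ 3) Y3 k4 vk2 k3.
by move=> a b c e *; lra.
Qed.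

(** The expansion is [ln |zeta + tau| = ln |zeta| + Re (tau / zeta) - Re ((tau / zeta) ^ 2) / 2 +
    O(|tau| ^ 3)]; the radius [r1 / 2] keeps [zeta + tau] away from 0. *)
Lemma superharmonic2_ln (r1 : R) zeta : 0 < r1 -> r1 <= absC zeta ->
  superharmonic2 (r1 / 2) (6 / r1 ^+ 3) 0 (fun tau => ln (absC (zeta + tau))).
Proof.
move=> r10 hz.
have z0 : 0 < absC zeta by exact: lt_le_trans hz.
have lnsq (x : R) : 0 < x -> ln x = ln (x ^+ 2) / 2.
  by move=> x0; rewrite lnXn// -[_ *+ 2]mulr_natr mulfK.
have [q qdef] : exists q, q = absC zeta ^+ 2 by eexists.
have [x xdef] : exists x, x = complex.Re zeta by eexists.
have [y ydef] : exists y, y = complex.Im zeta by eexists.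
have q0 : 0 < q by rewrite qdef exprn_gt0.
have qn0 : q != 0 by rewrite gt_eqF.
exists (x / q), (y / q), (- (x ^+ 2 - y ^+ 2) / q ^+ 2 / 2),
  (- (2 * x * y) / q ^+ 2 / 2) => tau ht.
have zt : 0 < absC (zeta + tau).
  have := absCD (zeta + tau) (- tau); rewrite absCN addrK.
  by move: (absC zeta) (absC tau) (absC (zeta + tau)) hz ht => l h e *; lra.
rewrite addr0 (lnsq (absC (zeta + tau)))// (lnsq (absC zeta))// -qdef.
have [h hdef] : exists h, h = absC tau by eexists.
have [s sdef] : exists s, s = complex.Re tau by eexists.
have [t tdef] : exists t, t = complex.Im tau by eexists.
(* [A] and [B] are the real and imaginary parts of [tau] times the conjugate of [zeta], so [A / q]
   is [Re (tau / zeta)] and [h / l] is [|tau / zeta|]. *)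
have [A Adef] : exists A, A = x * s + y * t by eexists.
have [B Bdef] : exists B, B = x * t - y * s by eexists.
have [l ldef] : exists l, l = absC zeta by eexists.
have hE : h ^+ 2 = s ^+ 2 + t ^+ 2 by rewrite hdef sdef tdef sqr_absC.
have qE : q = x ^+ 2 + y ^+ 2 by rewrite qdef xdef ydef sqr_absC.
have ztE : absC (zeta + tau) ^+ 2 = q + 2 * A + h ^+ 2.
  rewrite hE qE sqr_absC Adef xdef ydef sdef tdef.
  by case: (zeta) => ? ?; case: (tau) => ? ? /=; ring.
have h0 : 0 <= h by rewrite hdef absC_ge0.
have AB : A ^+ 2 + B ^+ 2 = q * h ^+ 2 by rewrite hE qE Adef Bdef; ring.
rewrite /harm2 -sdef -tdef -hdef; rewrite -hdef in ht.
rewrite -ldef in qdef hz z0.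
have {ztE}ztE : absC (zeta + tau) ^+ 2 = q * (1 + (2 * (A / q) + (h / l) ^+ 2)).
  by rewrite ztE expr_div_n -qdef; field.
have Y1 : 0 < 1 + (2 * (A / q) + (h / l) ^+ 2).
  by have := exprn_gt0 2 zt; rewrite ztE pmulr_rgt0.
rewrite ztE lnM ?posrE//.
have Ale : `|A| <= l * h.
  rewrite -(ler_pXn2r (n := 2))// ?nnegrE ?mulr_ge0// ?(ltW z0)//.
  by rewrite real_normK ?num_real// exprMn -qdef -AB lerDl sqr_ge0.
have k0 : 0 <= h / l by rewrite divr_ge0 ?(ltW z0).
have kle : h / l <= h / r1 by rewrite ler_wpM2l// lef_pV2 ?posrE.
have k1 : h / l <= 1.
  by rewrite ler_pdivrMr// mul1r; lra.
have Aq : `|A / q| <= h / l.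
  rewrite normrM (gtr0_norm (x := q^-1)) ?invr_gt0// ler_pdivrMr//.
  by rewrite qdef expr2 mulrA divfK ?gt_eqF// mulrC.
have harmE : x / q * s + y / q * t
    + - (x ^+ 2 - y ^+ 2) / q ^+ 2 / 2 * (s ^+ 2 - t ^+ 2)
    + - (2 * x * y) / q ^+ 2 / 2 * (2 * s * t)
    = A / q + (h / l) ^+ 2 / 2 - (A / q) ^+ 2.
  have -> : (h / l) ^+ 2 / 2 = (A ^+ 2 + B ^+ 2) / q ^+ 2 / 2.
    by rewrite AB expr_div_n -qdef; field.
  by rewrite Adef Bdef; field.
have kk : 6 * (h / l) ^+ 3 <= 6 / r1 ^+ 3 * h ^+ 3.
  have -> : 6 / r1 ^+ 3 * h ^+ 3 = 6 * (h / r1) ^+ 3 by field; rewrite gt_eqF.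
  by rewrite ler_pM2l// ler_pXn2r// nnegrE divr_ge0// ltW.
rewrite harmE mul0r subr0.
move: (ln_taylor2 k0 k1 Aq Y1) kk.
by lra.
Qed.
End Superharmonicity.

(** * Second-order expansion of the curve and of the squared distance to it *)

Section PolynomialCurves.
Context {R : realType}.
Implicit Types (tau zeta : R[i]).

(** The point is that [C] is uniform in [zeta]. Multiplying the expansion by [zeta + tau], of
    modulus at most 2, gives the next one, with new remainder [(zeta + tau) * r + c2 * tau ^+ 3]. *)
Lemma expr_taylor2 N : exists2 C : R, 0 <= C & forall zeta, absC zeta <= 1 ->
  exists c1 c2 : R[i], [/\ absC c1 <= C, absC c2 <= C &
    forall tau, absC tau <= 1 ->
      absC ((zeta + tau) ^+ N - zeta ^+ N - c1 * tau - c2 * tau ^+ 2)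
        <= C * absC tau ^+ 3].
Proof.
elim: N => [|N [C C0 IH]].
  exists 0 => // zeta _; exists 0, 0; rewrite absC0; split => // tau _.
  by rewrite !expr0 !mul0r subrr !subr0 absC0.
exists (3 * C + 1); first by lra.
move=> zeta hz; have [c1 [c2 [h1 h2 H]]] := IH _ hz.
have z0 := absC_ge0 zeta.
have zN : absC (zeta ^+ N) <= 1 by rewrite absCX exprn_ile1.
exists (zeta * c1 + zeta ^+ N), (zeta * c2 + c1); split.
- apply: le_trans (absCD _ _) _; rewrite absCM.
  have : absC zeta * absC c1 <= 1 * C by rewrite ler_pM ?absC_ge0.
  by lra.
- apply: le_trans (absCD _ _) _; rewrite absCM.
  have : absC zeta * absC c2 <= 1 * C by rewrite ler_pM ?absC_ge0.
  by lra.
move=> tau ht; have t0 := absC_ge0 tau.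
set r := (_ - _ - _ - _).
have -> : r = (zeta + tau) *
    ((zeta + tau) ^+ N - zeta ^+ N - c1 * tau - c2 * tau ^+ 2) + c2 * tau ^+ 3.
  rewrite /r !exprS; ring.
apply: le_trans (absCD _ _) _; rewrite (absCM (zeta + tau)) (absCM c2) absCX.
have t3 : 0 <= absC tau ^+ 3 by rewrite exprn_ge0.
have : absC (zeta + tau) * absC ((zeta + tau) ^+ N - zeta ^+ N - c1 * tau
    - c2 * tau ^+ 2) <= 2 * (C * absC tau ^+ 3).
  apply: ler_pM; rewrite ?absC_ge0 ?H//; apply: le_trans (absCD _ _) _; lra.
have : absC c2 * absC tau ^+ 3 <= C * absC tau ^+ 3 by rewrite ler_wpM2r.
by lra.
Qed.

(** [P] is the deviation of the curve from its tangent. Up to third order the cross term of the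
    square is the real part of a multiple of [tau ^ 2], hence harmonic, while [|P| ^ 2] has order
    four. *)
Lemma superharmonic2_sqr_eucl n (e w : Cn R n) (P : R[i] -> R[i]) (c2 : R[i])
    (C : R) :
  0 <= C -> eucl e <= 1 -> eucl w <= 1 -> absC c2 <= C -> P 0 = 0 ->
  (forall tau, absC tau <= 1 ->
    absC (P tau - c2 * tau ^+ 2) <= C * absC tau ^+ 3) ->
  superharmonic2 1 (4 * C + 4 * C ^+ 2) 0 (fun tau => eucl (e - P tau *: w) ^+ 2).
Proof.
move=> C0 he hw hc2 P0 HP.
pose er j := complex.Re (e ord0 j); pose ei j := complex.Im (e ord0 j).
pose wr j := complex.Re (w ord0 j); pose wi j := complex.Im (w ord0 j).
pose hr := \sum_j (er j * wr j + ei j * wi j).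
pose hi := \sum_j (er j * wi j - ei j * wr j).
have expand x : eucl (e - x *: w) ^+ 2 = eucl e ^+ 2
    - 2 * (complex.Re x * hr - complex.Im x * hi) + absC x ^+ 2 * eucl w ^+ 2.
  rewrite !sqr_eucl /hr /hi !mulr_sumr -sumrB mulr_sumr -sumrB -big_split/=.
  apply: eq_bigr => j _; rewrite !mxE !sqr_absC /er /ei /wr /wi.
  case: (e ord0 j) => a b; case: (w ord0 j) => c d; case: x => x y /=; ring.
have sq1 (v : Cn R n) : eucl v <= 1 -> \sum_j absC (v ord0 j) ^+ 2 <= 1.
  by move=> hv; rewrite -sqr_eucl exprn_ile1// eucl_ge0.
have hrhi : `|hr| <= 1 /\ `|hi| <= 1.
  have sumle (f : 'I_n -> R) : (forall j, `|f j| <=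
      (absC (e ord0 j) ^+ 2 + absC (w ord0 j) ^+ 2) / 2) -> `|\sum_j f j| <= 1.
    move=> hf; apply: le_trans (ler_norm_sum _ _ _) _.
    apply: le_trans (ler_sum _ (fun j _ => hf j)) _.
    rewrite -mulr_suml big_split/=; have := sq1 _ he; have := sq1 _ hw; lra.
  split; apply: sumle => j; rewrite !sqr_absC -/(er j) -/(ei j) -/(wr j) -/(wi j);
    rewrite ler_norml; apply/andP; split.
  - have := sqr_ge0 (er j + wr j); have := sqr_ge0 (ei j + wi j); lra.
  - have := sqr_ge0 (er j - wr j); have := sqr_ge0 (ei j - wi j); lra.
  - have := sqr_ge0 (er j + wi j); have := sqr_ge0 (ei j - wr j); lra.
  - have := sqr_ge0 (er j - wi j); have := sqr_ge0 (ei j + wr j); lra.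
case: hrhi => hhr hhi.
set al := complex.Re c2; set be := complex.Im c2.
exists 0, 0, (- 2 * (al * hr - be * hi)), (2 * (be * hr + al * hi)) => tau ht.
rewrite P0 scale0r subr0 mul0r subr0 expand.
have [r rdef] : exists r, r = P tau - c2 * tau ^+ 2 by eexists.
have Pr : P tau = c2 * tau ^+ 2 + r by rewrite rdef addrC subrK.
have t0 := absC_ge0 tau.
have hr3 : absC r <= C * absC tau ^+ 3 by rewrite rdef; exact: HP.
have t32 : absC tau ^+ 3 <= absC tau ^+ 2 by rewrite exprS ler_piMl// sqr_ge0.
have t43 : (absC tau ^+ 2) ^+ 2 <= absC tau ^+ 3.
  have -> : (absC tau ^+ 2) ^+ 2 = absC tau * absC tau ^+ 3 by ring.
  by rewrite ler_piMl// exprn_ge0.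
have hP : absC (P tau) <= 2 * C * absC tau ^+ 2.
  rewrite Pr; apply: le_trans (absCD _ _) _; rewrite absCM absCX.
  have -> : 2 * C * absC tau ^+ 2 = C * absC tau ^+ 2 + C * absC tau ^+ 2 by ring.
  apply: lerD; first by rewrite ler_wpM2r// sqr_ge0.
  by apply: le_trans hr3 _; rewrite ler_wpM2l.
have P2 : absC (P tau) ^+ 2 * eucl w ^+ 2 <= 4 * C ^+ 2 * absC tau ^+ 3.
  apply: (@le_trans _ _ ((2 * C * absC tau ^+ 2) ^+ 2 * 1)).
    apply: ler_pM; rewrite ?sqr_ge0// ?exprn_ile1 ?eucl_ge0//.
    by rewrite ler_pXn2r ?nnegrE ?absC_ge0// !mulr_ge0 ?sqr_ge0.
  rewrite mulr1 exprMn; have -> : (2 * C) ^+ 2 = 4 * C ^+ 2 by ring.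
  by rewrite ler_wpM2l// mulr_ge0 ?sqr_ge0.
have lin : - (complex.Re r * hr - complex.Im r * hi) <= 2 * (C * absC tau ^+ 3).
  apply: le_trans (ler_norm _) _; rewrite normrN.
  apply: le_trans (ler_normB _ _) _; rewrite !normrM.
  have a1 : `|complex.Re r| * `|hr| <= absC r * 1.
    by rewrite ler_pM// normr_Re_le.
  have a2 : `|complex.Im r| * `|hi| <= absC r * 1.
    by rewrite ler_pM// normr_Im_le.
  by move: (_ * `|hr|) (_ * `|hi|) (C * _) (absC r) a1 a2 hr3 => *; lra.
have ReP : complex.Re (P tau) = al * (complex.Re tau ^+ 2 - complex.Im tau ^+ 2)
    - be * (2 * complex.Re tau * complex.Im tau) + complex.Re r.
  rewrite Pr /al /be.
  by case: (c2) => ? ?; case: (tau) => ? ?; case: (r) => ? ? /=; ring.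
have ImP : complex.Im (P tau) = be * (complex.Re tau ^+ 2 - complex.Im tau ^+ 2)
    + al * (2 * complex.Re tau * complex.Im tau) + complex.Im r.
  rewrite Pr /al /be.
  by case: (c2) => ? ?; case: (tau) => ? ?; case: (r) => ? ? /=; ring.
rewrite ReP ImP /harm2.
move: (complex.Re tau ^+ 2 - complex.Im tau ^+ 2) => X.
move: (2 * complex.Re tau * complex.Im tau) => Y.
move: (complex.Re tau) (complex.Im tau) => s t.
move: (complex.Re r) (complex.Im r) lin => r1 r2 lin.
move: (_ * eucl w ^+ 2) (eucl e ^+ 2) (absC tau ^+ 3) P2 lin.
move=> *.
lra.
Qed.
End PolynomialCurves.

(** * Abstract maximum principle and comparison of extended reals *)

(** No maximum has to be attained: each application of the improvement step lowers the global excess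
    of [u] over [G] by the fixed amount [kap], so finitely many bring it down to 0. *)
Lemma strict_maximum_principle (R : realType) (X : Type) (P : X -> Prop)
    (u : X -> \bar R) (G : X -> R) (M kap : R) :
  0 < kap ->
  (forall x, P x -> (u x <= (G x + M)%:E)%E) ->
  (forall S x, 0 <= S -> P x -> ((G x)%:E < u x)%E ->
    (forall y, P y -> (u y <= (G y + S)%:E)%E) ->
    (u x <= (G x + (S - kap))%:E)%E) ->
  forall x, P x -> (u x <= (G x)%:E)%E.
Proof.
move=> kap0 uM step.
have iter n x : P x -> (u x <= (G x + Num.max 0 (M - n%:R * kap))%:E)%E.
  elim: n x => [|n IHn] x Px.
    apply: le_trans (uM _ Px) _.
    by rewrite lee_fin lerD2l mul0r subr0 le_max lexx orbT.
  have [uG|Gu] := leP (u x) (G x)%:E.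
    by apply: le_trans uG _; rewrite lee_fin lerDl le_max lexx.
  have [S0|Sn0] := leP (M - n%:R * kap) 0.
    have := IHn _ Px; rewrite (max_idPl S0) addr0 => /(lt_le_trans Gu).
    by rewrite ltxx.
  apply: le_trans (step (M - n%:R * kap) x (ltW Sn0) Px Gu _) _.
    by move=> y Py; have := IHn _ Py; rewrite (max_idPr (ltW Sn0)).
  rewrite lee_fin lerD2l le_max; apply/orP; right.
  by rewrite -natr1 mulrDl mul1r opprD addrA.
move=> x Px; have := iter (Num.bound `|M / kap|) _ Px.
rewrite (max_idPl _) ?addr0// subr_le0 -ler_pdivrMr//.
exact: le_trans (ler_norm _) (ltW (archi_boundP (normr_ge0 _))).
Qed.

(** Lets quotients and Lelong numbers, a priori infinite, be compared through real levels [A]. *)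
Lemma lee_lt_real (R : realType) (x y : \bar R) :
  (forall A : R, (A%:E < x)%E -> (A%:E <= y)%E) -> (x <= y)%E.
Proof.
case: x y => [r||] [s||] // H; rewrite ?leey ?leNye//.
- rewrite lee_fin leNgt; apply/negP => sr.
  by have := H ((r + s) / 2); rewrite lte_fin lee_fin; lra.
- by have := H (r - 1); rewrite lte_fin leeNy_eq => /(_ _); apply; lra.
- by have := H (s + 1)%R (ltry (s + 1)%R); rewrite lee_fin leNgt ltrDl ltr01.
- by have := H 0%R (ltry 0%R); rewrite leeNy_eq.
Qed.

(** * The maximum principle along a polynomial curve *)

Section SubMeanValue.
Context {R : realType} {k m : nat}.
Variable u : Cn R (k + m) -> \bar R.
Hypothesis u_submean : forall a b : Cn R (k + m),
  (forall zeta : R[i], absC zeta <= 1 -> polydisc (a + zeta *: b)) ->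
  (u a <= ((2 * pi)^-1)%:E *
     \int[@lebesgue_measure R]_(t in `[0%R, (2 * pi)%R]%classic)
         u (a + expi t *: b)%R)%E.
Hypothesis u_le0 : forall z, polydisc z -> (u z <= 0)%E.

Lemma polydisc_row_mx (a : Cn R k) (b : Cn R m) :
  polydisc a -> eucl b < 1 -> polydisc (row_mx a b).
Proof.
move=> ha hb j; rewrite mxE; case: splitP => i _; first exact: ha.
exact: le_lt_trans (absC_le_eucl _ _) hb.
Qed.

(** The barrier lives on pairs of a parameter [zeta] and a displacement from the curve. Its
    logarithmic slope [K / ln r0] matches the level [K] on the inner part, and [u <= 0] controls the
    rest of the boundary; [Rr] and [eps] are slack to be removed later. *)
Lemma submean_curve_le (N : nat) (p d : Cn R k) (w : Cn R m)
    (r0 xi K Rr eps : R) :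
  (forall zeta, absC zeta < 1 -> polydisc (p + zeta *: d)) ->
  eucl w < 1 -> 0 < r0 -> r0 <= xi -> xi < Rr -> Rr < 1 -> 0 < eps -> K <= 0 ->
  (forall zeta (w' : Cn R m), absC zeta <= r0 -> eucl w' < r0 ^+ N ->
     (u (row_mx (p + zeta *: d) w') <= K%:E)%E) ->
  (u (row_mx (p + xi%:C%C *: d) (xi%:C%C ^+ N *: w)) <=
    (K / ln r0 * (ln xi - ln Rr) + eps * (1 - xi ^+ 2))%:E)%E.
Proof.
move=> hpd hw r00 r0xi xiR R1 eps0 K0 hK.
have R0 : 0 < Rr by lra.
have lnr0 : ln r0 < 0 by rewrite ln_lt0// r00/=; lra.
have [B Bdef] : exists B, B = K / ln r0 by eexists.
rewrite -Bdef.
have B0 : 0 <= B by rewrite Bdef -mulrNN mulr_ge0// oppr_ge0// invr_le0 ltW.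
have BK : B * ln r0 = K by rewrite Bdef divfK// lt_eqF.
have [r1 r1def] : exists r1, r1 = r0 * Rr by eexists.
have r10 : 0 < r1 by rewrite r1def mulr_gt0.
have r1r0 : r1 < r0 by rewrite r1def gtr_pMr.
have lnr1 : ln r1 - ln Rr = ln r0 by rewrite r1def lnM ?posrE// addrK.
(* The tube of radius [2 * gam] about the curve stays in the unit ball, and over [absC zeta <= r0]
   in the ball of radius [r0 ^+ N] where [u] is at most [K]. *)
have [gam gamdef] : exists gam, gam = r0 ^+ N * (1 - eucl w) / 2 by eexists.
have r0N : 0 < r0 ^+ N by rewrite exprn_gt0.
have r0N1 : r0 ^+ N <= 1 by rewrite exprn_ile1// ltW//; lra.
have w0 := eucl_ge0 w.
have gam0 : 0 < gam by rewrite gamdef divr_gt0// mulr_gt0//; lra.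
have gamr : r0 ^+ N * eucl w + 2 * gam = r0 ^+ N by rewrite gamdef; field.
have gam1 : eucl w + 2 * gam <= 1.
  have : 2 * gam <= 1 - eucl w.
    rewrite gamdef mulrC divfK//; apply: ler_piMl => //; lra.
  lra.
(* The penalty reaches [- K] at distance [gam] from the curve. *)
have [Cg Cgdef] : exists Cg, Cg = - K / gam ^+ 2 by eexists.
have Cg0 : 0 <= Cg by rewrite Cgdef divr_ge0 ?sqr_ge0// oppr_ge0.
have [C C0 HC] := @expr_taylor2 R N.
have [D Ddef] : exists D,
    D = B * (6 / r1 ^+ 3) + Cg * (4 * C + 4 * C ^+ 2) + eps * 0.
  by eexists.
have D0 : 0 <= D.
  rewrite Ddef mulr0 addr0 addr_ge0// mulr_ge0//.
    by rewrite divr_ge0// exprn_ge0// ltW.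
  by rewrite addr_ge0// mulr_ge0// sqr_ge0.
(* The first two bounds validate the expansions, the next three keep tangent discs inside [dom], and
   the last makes the error [D * rho ^+ 3] cost at most half of the gain [eps * rho ^+ 2]. *)
have [rho rho0 [hr1 hr2 hr3 [hr4 hr5 hr6]]] : exists2 rho, 0 < rho &
    [/\ rho <= r1 / 2, rho <= 1, rho <= 1 - Rr &
     [/\ rho <= r0 - r1, rho * (2 * C + 1) <= gam & rho * (2 * (D + 1)) <= eps]].
  have e1 : 0 < 2 * C + 1 by lra.
  have e2 : 0 < 2 * (D + 1) by lra.
  exists (Num.min (Num.min (Num.min (r1 / 2) 1) (Num.min (1 - Rr) (r0 - r1)))
    (Num.min (gam / (2 * C + 1)) (eps / (2 * (D + 1))))).
    by rewrite !lt_min ltr01 !subr_gt0 R1 r1r0 (divr_gt0 r10)//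
      (divr_gt0 gam0 e1) (divr_gt0 eps0 e2).
  split; last split;
    first [rewrite -(ler_pdivlMr _ _ e1) | rewrite -(ler_pdivlMr _ _ e2) | idtac];
    by rewrite !ge_min lexx ?orbT.
pose pt (x : R[i] * Cn R m) : Cn R (k + m) :=
  row_mx (p + x.1 *: d) (x.1 ^+ N *: w + x.2).
pose dom (x : R[i] * Cn R m) :=
  [/\ r1 < absC x.1, absC x.1 < 1 & eucl x.2 < 2 * gam].
(* [G] dominates [K] where [absC x.1 <= r0], and is nonnegative where
   [Rr <= absC x.1] or [gam <= eucl x.2]; the choice [r1 = r0 * Rr] makes this
   hold on a slightly larger domain, which leaves room for discs of radius
   [rho]. *)
pose G (x : R[i] * Cn R m) : R :=
  B * (ln (absC x.1) - ln Rr) + Cg * eucl x.2 ^+ 2 + eps * (1 - absC x.1 ^+ 2).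
have ptle z e : eucl (z ^+ N *: w + e) <= absC z ^+ N * eucl w + eucl e.
  by apply: le_trans (euclD _ _) _; rewrite euclZ absCX.
have dom_polydisc x : dom x -> polydisc (pt x).
  case: x => z e [/= z1 z2 he]; apply: polydisc_row_mx; first exact: hpd.
  apply: le_lt_trans (ptle z e) _; apply: lt_le_trans gam1.
  by rewrite ler_ltD// ler_piMl// exprn_ile1 ?absC_ge0// ltW.
have Gge x : dom x -> K <= B * (ln (absC x.1) - ln Rr).
  case: x => z e [/= z1 z2 he]; rewrite -BK -lnr1 ler_wpM2l// lerD2r.
  by rewrite ler_ln ?posrE// ?(ltW z1)// (lt_trans r10).
have G2 x : 0 <= Cg * eucl x ^+ 2 by rewrite mulr_ge0 ?sqr_ge0.
have G3 z : absC z < 1 -> 0 <= eps * (1 - absC z ^+ 2).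
  move=> z1; rewrite mulr_ge0 ?(ltW eps0)// subr_ge0 exprn_ile1 ?absC_ge0//.
  exact: ltW.
(* Where [u] exceeds [G], [G] is negative because [u <= 0]; this excludes the outer and lateral
   margins, and the bound by [K] excludes the inner one. *)
have core x : dom x -> ((G x)%:E < u (pt x))%E ->
    [/\ r0 < absC x.1, absC x.1 < Rr & eucl x.2 < gam].
  move=> hx; have Gx := Gge _ hx; have ux := u_le0 (dom_polydisc _ hx).
  case: x hx Gx ux => z e [/= z1 z2 he] Gx ux Gu.
  have G0 : G (z, e) < 0 by rewrite -lte_fin; exact: lt_le_trans Gu ux.
  split; rewrite ltNge; apply/negP.
  - move=> zr; have : (u (pt (z, e)) <= K%:E)%E.
      apply: hK => //; apply: le_lt_trans (ptle z e) _; rewrite -gamr.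
      by rewrite ler_ltD// ler_wpM2r// lerXn2r ?nnegrE ?absC_ge0// ltW.
    move=> /(lt_le_trans Gu); rewrite lte_fin ltNge => /negP; apply.
    by apply: le_trans Gx _; rewrite /G -addrA lerDl addr_ge0// G3.
  - move=> zR; move: G0; rewrite ltNge => /negP; apply.
    rewrite /G/= !addr_ge0// ?G3// mulr_ge0// subr_ge0 ler_ln ?posrE//.
    exact: lt_le_trans zR.
  - move=> ge; move: G0; rewrite ltNge => /negP; apply.
    rewrite /G/= addr_ge0// ?G3// -(subrr K) lerD//.
    rewrite Cgdef mulrAC ler_pdivlMr ?exprn_gt0// ler_wpM2l ?oppr_ge0//.
    by rewrite ler_pXn2r ?nnegrE ?eucl_ge0// ltW.
have main : forall x, dom x -> ((u \o pt) x <= (G x)%:E)%E.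
  apply: (@strict_maximum_principle _ _ dom _ G (- K) (eps * rho ^+ 2 / 2)).
  - by rewrite divr_gt0// mulr_gt0// exprn_gt0.
  - move=> x hx; apply: le_trans (u_le0 (dom_polydisc _ hx)) _.
    rewrite lee_fin -(subrr K) lerD2r; apply: le_trans (Gge _ hx) _.
    by rewrite /G -addrA lerDl addr_ge0//; case: hx => _ z1 _; exact: G3.
  move=> S [z e] S0 hx Gu HS; have [/= x1 x2 x3] := core _ hx Gu.
  have [c1 [c2 [_ hc2 HP]]] := HC z (ltW (lt_trans x2 R1)).
  pose P tau := (z + tau) ^+ N - z ^+ N - c1 * tau.
  have P0 : P 0 = 0 by rewrite /P addr0 mulr0 subr0 subrr.
  have Pc2 tau : absC tau <= 1 -> absC (P tau - c2 * tau ^+ 2) <= C * absC tau ^+ 3.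
    exact: HP.
  have [aa [bb [cc [dd hf]]]] : superharmonic2 rho D eps (fun tau =>
      B * ln (absC (z + tau)) + Cg * eucl (e - P tau *: w) ^+ 2
      + eps * (1 - absC (z + tau) ^+ 2)).
    have kapE : B * 0 + Cg * 0 + eps * 1 = eps by ring.
    rewrite Ddef -[X in superharmonic2 _ _ X]kapE; apply: superharmonic2D.
      apply: superharmonic2D; apply: superharmonic2Z => //.
        by apply: superharmonic2_weak (superharmonic2_ln r10 (ltW _)) => //; lra.
      apply: superharmonic2_weak hr2 (lexx _) _.
      by apply: (@superharmonic2_sqr_eucl _ _ _ _ _ c2) => //; lra.
    by apply: superharmonic2Z; [exact: ltW | exact: superharmonic2_sqr_absC].
  pose b : Cn R (k + m) := row_mx (rho%:C%C *: d) ((rho%:C%C * c1) *: w).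
  (* In the coordinates (parameter, displacement), moving along the affine tangent disc advances the
     parameter and shifts the displacement by the deviation [P] of the curve from its tangent. *)
  pose next eta : R[i] * Cn R m :=
    (z + rho%:C%C * eta, e - P (rho%:C%C * eta) *: w).
  have nextE eta : pt (z, e) + eta *: b = pt (next eta).
    rewrite /pt/= /b scale_row_mx add_row_mx; congr row_mx.
      by rewrite scalerDl scalerA [eta * _]mulrC addrA.
    by apply/rowP => j; rewrite /P !mxE; ring.
  have absrho eta : absC eta <= 1 -> absC (rho%:C%C * eta) <= rho.
    move=> he; rewrite absCM absC_real gtr0_norm//; apply: ler_piMr => //.
    exact: ltW.
  have next_dom eta : absC eta <= 1 -> dom (next eta).
    rewrite /dom /next/= => /absrho; move: (rho%:C%C * eta) => tau ht.
    have t0 := absC_ge0 tau; have t1 : absC tau <= 1 by lra.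
    split.
    - have := absCD (z + tau) (- tau); rewrite absCN addrK.
      by move: (absC z) (absC tau) (absC (z + tau)) x1 ht => *; lra.
    - apply: le_lt_trans (absCD _ _) _.
      by move: (absC z) (absC tau) x2 ht => *; lra.
    rewrite -scaleNr; apply: le_lt_trans (euclD _ _) _; rewrite euclZ absCN.
    have t2 : absC tau ^+ 2 <= absC tau by rewrite expr2 ler_piMr.
    have t3 : absC tau ^+ 3 <= absC tau.
      by rewrite exprS; apply: ler_piMr => //; exact: exprn_ile1.
    have Pg : absC (P tau) <= gam.
      rewrite -[P tau](subrK (c2 * tau ^+ 2)); apply: le_trans (absCD _ _) _.
      apply: le_trans (_ : C * rho + C * rho <= _); last by lra.
      apply: lerD; first by apply: le_trans (Pc2 _ t1) _; rewrite ler_wpM2l//; lra.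
      rewrite absCM absCX; apply: ler_pM; rewrite ?absC_ge0 ?sqr_ge0//; lra.
    have : absC (P tau) * eucl w <= gam * 1.
      by apply: ler_pM; rewrite ?absC_ge0//; lra.
    by move: (absC (P tau) * eucl w) (eucl e) x3 => *; lra.
  apply: le_trans (u_submean (a := pt (z, e)) (b := b) _) _.
    by move=> eta he; rewrite nextE; exact/dom_polydisc/next_dom.
  apply: (@circle_mean_le _ _ _ aa bb cc dd rho) => t.
  rewrite nextE; apply: le_trans (HS _ (next_dom _ _)) _.
    by rewrite absC_expi.
  have trho : absC (rho%:C%C * expi t) = rho.
    by rewrite absCM absC_expi mulr1 absC_real gtr0_norm.
  have rD : D * rho ^+ 3 <= eps * rho ^+ 2 / 2.
    have := ler_wpM2r (sqr_ge0 rho) hr6.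
    have := mulr_ge0 (ltW rho0) (sqr_ge0 rho); rewrite -exprS.
    have -> : rho * (2 * (D + 1)) * rho ^+ 2 =
      2 * (D * rho ^+ 3) + 2 * rho ^+ 3 by ring.
    by move: (D * rho ^+ 3) (rho ^+ 3) (eps * rho ^+ 2) => *; lra.
  have := hf (rho%:C%C * expi t); rewrite trho lexx P0 scale0r subr0 addr0.
  move=> /(_ isT); rewrite lee_fin /G/=.
  move: rD; move: (rho%:C%C * expi t) => tau.
  move: (harm2 _ _ _ _ _) (ln (absC (z + tau))) (ln (absC z)) (ln Rr).
  move: (absC (z + tau) ^+ 2) (absC z ^+ 2) (eucl _ ^+ 2) (eucl _ ^+ 2).
  move: (D * rho ^+ 3) (rho ^+ 2) => *; lra.
have xi0 : 0 < xi by lra.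
have : dom (xi%:C%C, 0).
  rewrite /dom/= absC_real gtr0_norm// -[0](scale0r w) euclZ absC0 mul0r.
  by split; lra.
move=> /main; rewrite /= /pt/= addr0 /G/= absC_real gtr0_norm//.
by rewrite -[X in eucl X](scale0r w) euclZ absC0 mul0r expr0n mulr0 addr0.
Qed.

(** The slack disappears as [Rr = expR (- t)] tends to 1 and [eps] to 0. *)
Lemma curve_le (N : nat) (p d : Cn R k) (w : Cn R m) (r0 xi K : R) :
  (forall zeta, absC zeta < 1 -> polydisc (p + zeta *: d)) ->
  eucl w < 1 -> 0 < r0 -> r0 <= xi -> xi < 1 -> K <= 0 ->
  (forall zeta (w' : Cn R m), absC zeta <= r0 -> eucl w' < r0 ^+ N ->
     (u (row_mx (p + zeta *: d) w') <= K%:E)%E) ->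
  (u (row_mx (p + xi%:C%C *: d) (xi%:C%C ^+ N *: w)) <=
    (K / ln r0 * ln xi)%:E)%E.
Proof.
move=> hpd hw r00 r0xi xi1 K0 hK; apply/lee_addgt0Pr => eta eta0.
have xi0 : 0 < xi by lra.
have lnr0 : ln r0 < 0 by rewrite ln_lt0// r00/=; lra.
have lnxi : ln xi < 0 by rewrite ln_lt0// xi0.
have B0 : 0 <= K / ln r0 by rewrite -mulrNN mulr_ge0// oppr_ge0// invr_le0 ltW.
have B1 : 0 < 2 * (K / ln r0 + 1) by lra.
have [t t0 [t1 t2]] : exists2 t, 0 < t &
    t <= - ln xi / 2 /\ t * (2 * (K / ln r0 + 1)) <= eta.
  exists (Num.min (- ln xi / 2) (eta / (2 * (K / ln r0 + 1)))).
    by rewrite lt_min (divr_gt0 eta0 B1) divr_gt0// oppr_gt0.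
  by rewrite -ler_pdivlMr// !ge_min !lexx orbT.
apply: le_trans (submean_curve_le (Rr := expR (- t))
  (eps := eta / 2) hpd hw r00 r0xi _ _ _ K0 hK) _.
- by rewrite -[ltLHS]lnK ?posrE// ltr_expR; lra.
- by rewrite expR_lt1; lra.
- by lra.
rewrite -EFinD lee_fin expRK opprK mulrDr -addrA lerD2l.
have xi2 : 0 <= xi ^+ 2 by rewrite sqr_ge0.
have : eta / 2 * (1 - xi ^+ 2) <= eta / 2 by rewrite ler_piMr; lra.
by move: (K / ln r0) t2 (xi ^+ 2) => b *; lra.
Qed.

(** * Lelong numbers of slices as infima of monotone quotients *)

Definition slice (z' : Cn R k) : Cn R m -> \bar R := fun w => u (row_mx z' w).

Definition ratio (z' : Cn R k) (r : R) : \bar R :=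
  (supball (slice z') r * ((ln r)^-1)%:E)%E.

Lemma le_ratioE (A : R) z' r : 0 < r -> r < 1 ->
  (A%:E <= ratio z' r)%E <->
  forall w, eucl w < r -> (u (row_mx z' w) <= (A * ln r)%:E)%E.
Proof.
move=> r0 r1; have lnr : ln r < 0 by rewrite ln_lt0// r0.
rewrite /ratio lee_ndivlMr// -EFinM /supball; split.
  by move=> /ereal_supP H w hw; apply: H; exists w.
by move=> H; apply/ereal_supP => _ [w hw <-]; exact: H.
Qed.

Lemma ratio_ge0 z' r : polydisc z' -> 0 < r -> r < 1 -> (0 <= ratio z' r)%E.
Proof.
move=> hz r0 r1; apply/(le_ratioE 0 z' r0 r1) => w hw; rewrite mul0r.
by apply: u_le0; apply: polydisc_row_mx => //; lra.
Qed.

(** This is the curve bound with [d = 0] and [N = 1], on the radial disc through [w], at parameter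
    [s]. *)
Lemma le_ratio z' r s : polydisc z' -> 0 < r -> r <= s -> s < 1 ->
  (ratio z' r <= ratio z' s)%E.
Proof.
move=> hz r0 rs s1; have s0 : 0 < s by lra.
have r1 : r < 1 by lra.
apply: lee_lt_real => A /ltW Ar.
have [A0|A0] := leP A 0.
  by apply: le_trans (ratio_ge0 hz s0 s1); rewrite lee_fin.
have lnr : ln r < 0 by rewrite ln_lt0// r0.
apply/(le_ratioE A z' s0 s1) => w hw.
have := @curve_le 1 z' 0 (s^-1%:C%C *: w) r s (A * ln r) _ _ r0 rs s1 _ _.
rewrite scaler0 addr0 expr1 scalerA -rmorphM divff ?gt_eqF// scale1r.
rewrite mulfK ?lt_eqF//; apply.
- by move=> zeta _; rewrite scaler0 addr0.
- by rewrite euclZ absC_real gtr0_norm ?invr_gt0// mulrC ltr_pdivrMr// mul1r.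
- by rewrite nmulr_lle0 ?ltW// -oppr_ge0 -mulrN mulr_ge0 ?ltW// oppr_gt0.
- move=> zeta w' _; rewrite scaler0 addr0 => hw'.
  by move/(le_ratioE A z' r0 r1): Ar; apply.
Qed.

Lemma le_lelong0E (A : R) z' : polydisc z' ->
  (A%:E <= lelong0 (slice z'))%E <->
  forall r, 0 < r -> r < 1 -> (A%:E <= ratio z' r)%E.
Proof.
move=> hz.
have -> : lelong0 (slice z') = ereal_inf (ratio z' @` `]0, 1[%classic).
  apply/cvg_lim => //.
  apply: (@nondecreasing_at_right_cvge _ _ _ (BLeft 1)); first by rewrite bnd_simp.
  move=> r s; rewrite !in_itv/= => /andP[r0 r1] /andP[s0 s1] rs.
  exact: le_ratio.
split.
  move=> /ereal_infP H r r0 r1; apply: H; exists r => //=.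
  by rewrite in_itv/= r0.
move=> H; apply/ereal_infP => y [r /=]; rewrite in_itv/= => /andP[r0 r1] <-.
exact: H.
Qed.

(** * Local and global constancy of the regularized function *)

(** A level [A] below [- phi_u u p] bounds the Lelong numbers from below near [p]; curves starting
    at [p] carry it to [a], reached at parameter [1 / 2]. *)
Lemma lelong0_le_phi (p a : Cn R k) :
  (forall zeta, absC zeta < 1 -> polydisc (p + zeta *: (2 *: (a - p)))) ->
  polydisc a -> (- lelong0 (slice a) <= phi_u u p)%E.
Proof.
move=> hpd ha.
rewrite leeNl; apply: lee_lt_real => A; rewrite lteNr -EFinN => /ereal_inf_ltP.
move=> [_ [del /= del0 <-]] hsup.
have [A0|A0] := leP A 0.
  apply/le_lelong0E => // r r0 r1.
  by apply: le_trans (ratio_ge0 ha r0 r1); rewrite lee_fin.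
set d : Cn R k := 2 *: (a - p).
have d0 := eucl_ge0 d.
have [r0 r00 [r0h r0d]] : exists2 r0 : R, 0 < r0 &
    r0 <= 2^-1 /\ r0 * (eucl d + 1) <= del / 2.
  exists (Num.min (2^-1) (del / 2 / (eucl d + 1))).
    by rewrite lt_min invr_gt0 ltr0n !divr_gt0//; lra.
  by rewrite -ler_pdivlMr ?ltr_wpDl// !ge_min !lexx orbT.
have near_p z : absC z <= r0 ->
    forall r, 0 < r -> r < 1 -> (A%:E <= ratio (p + z *: d)%R r)%E.
  move=> hz; have hq : polydisc (p + z *: d) by apply: hpd; lra.
  apply/le_lelong0E => //; rewrite -leeN2 -EFinN; apply: ltW.
  apply: le_lt_trans hsup; apply: ereal_sup_ubound; exists (p + z *: d) => //.
  split => //; rewrite /cdist addrAC subrr add0r euclZ.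
  have : absC z * eucl d <= r0 * eucl d by rewrite ler_wpM2r.
  by move: r0d; rewrite mulrDr; move: (absC z * eucl d) (r0 * eucl d) => *; lra.
have half0 : 0 < (2^-1 : R) by rewrite invr_gt0.
have half1 : (2^-1 : R) < 1 by rewrite invf_lt1// ltr1n.
(* With [K = A * ln (r0 ^+ N)] the slope is [A * N], so the bound at [1 / 2] is
   [A * ln (2^-1 ^+ N)]: the level [A] is kept exactly. By monotonicity the radii [2^-1 ^+ N]
   suffice. *)
have pts N : (0 < N)%N -> (A%:E <= ratio a (2^-1 ^+ N)%R)%E.
  move=> N0.
  have h0 : 0 < (2^-1 : R) ^+ N by rewrite exprn_gt0.
  have h1 : (2^-1 : R) ^+ N < 1 by rewrite exprn_ilt1 ?ltW// -lt0n.
  apply/le_ratioE => // w hw.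
  have rN0 : 0 < r0 ^+ N by rewrite exprn_gt0.
  have rN1 : r0 ^+ N < 1 by rewrite exprn_ilt1 ?(ltW r00) -?lt0n//; lra.
  have lnr0 : ln r0 < 0 by rewrite ln_lt0// r00/=; lra.
  have lnrN : ln (r0 ^+ N) < 0 by rewrite ln_lt0// rN0.
  have := @curve_le N p d ((2%:C%C) ^+ N *: w) r0 2^-1 (A * ln (r0 ^+ N)) hpd
    _ r00 r0h half1 _ _.
  have -> : A * ln (r0 ^+ N) / ln r0 * ln 2^-1 = A * ln (2^-1 ^+ N).
    rewrite !lnXn// -[ln r0 *+ N]mulr_natr -[ln 2^-1 *+ N]mulr_natr; field.
    by rewrite lt_eqF.
  have -> : 2^-1%:C%C ^+ N *: (2%:C%C ^+ N *: w) = w.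
    by rewrite scalerA -exprMn -rmorphM mulVf// rmorph1 expr1n scale1r.
  have -> : p + 2^-1%:C%C *: d = a.
    have -> : 2^-1%:C%C = (2 : R[i])^-1 by rewrite rmorphV ?unitfE// rmorph_nat.
    by rewrite /d scalerA mulVf ?pnatr_eq0// scale1r addrC subrK.
  apply.
  - rewrite euclZ absCX absC_real gtr0_norm// mulrC -ltr_pdivlMr ?exprn_gt0//.
    by rewrite mul1r -exprVn.
  - by rewrite pmulr_rle0// ltW.
  - move=> z w' hz; move: w'; apply/(le_ratioE A _ rN0 rN1).
    exact: near_p.
apply/le_lelong0E => // r ri0 ri1.
pose N := (Num.bound r^-1).+1.
apply: le_trans (pts N _) _ => //; apply: le_ratio => //.
rewrite exprVn -[leRHS]invrK lef_pV2 ?posrE ?exprn_gt0 ?invr_gt0//.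
apply: le_trans (ltW (archi_boundP _)) _; first by rewrite invr_ge0 ltW.
by rewrite -natrX ler_nat (leq_trans (leqnSn _))// ltnW// ltn_expl.
Qed.

(** Points [b] within [sig / 4] of [a] lie coordinatewise within [sig / 2] of [p], so the disc of
    direction [2 *: (b - p)] about [p] stays in the polydisc and [phi_u u p] bounds every
    [- nu(b)]. *)
Lemma phi_u_le (p a : Cn R k) (sig : R) : 0 < sig ->
  (forall j, absC (p ord0 j) <= 1 - sig) ->
  (forall j, absC (a ord0 j - p ord0 j) <= sig / 4) ->
  (phi_u u a <= phi_u u p)%E.
Proof.
move=> sig0 hp hap; apply: ge_ereal_inf.
eexists; first by exists (sig / 4) => //=; rewrite divr_gt0.
apply/ereal_supP => _ [b /= [hb hba] <-]; apply: lelong0_le_phi => // z z1 j.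
have hbp : absC (b ord0 j - p ord0 j) < sig / 2.
  have -> : b ord0 j - p ord0 j = (b - a) ord0 j + (a ord0 j - p ord0 j).
    by rewrite !mxE; ring.
  apply: le_lt_trans (absCD _ _) _.
  have := le_lt_trans (absC_le_eucl (b - a) j) hba.
  by move: (absC _) (absC _) (hap j) => *; lra.
rewrite !mxE; apply: le_lt_trans (absCD _ _) _; rewrite 2!absCM.
have -> : absC (2 : R[i]) = 2.
  by rewrite -[2 : R[i]](rmorph_nat (real_complex R)) absC_real ger0_norm.
have : absC z * (2 * absC (b ord0 j - p ord0 j)) <=
    1 * (2 * absC (b ord0 j - p ord0 j)).
  by rewrite ler_wpM2r ?mulr_ge0 ?absC_ge0// ltW.
by move: (absC (b ord0 j - _)) hbp (hp j) => c *; lra.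
Qed.

Lemma polydisc_gap (x : Cn R k) : polydisc x ->
  exists2 sig : R, 0 < sig & forall j, absC (x ord0 j) <= 1 - sig.
Proof.
move=> hx; exists (\big[Num.min/1]_j (1 - absC (x ord0 j))).
  by apply: lt_bigmin => // j _; rewrite subr_gt0; exact: hx.
by move=> j; rewrite lerBrDl -lerBrDr bigmin_le_cond.
Qed.

(** The gap [sig] of [x] serves the whole segment from 0 to [x]. Cut into steps of size at most
    [sig / 4], it allows the local comparison in both directions at each step. *)
Lemma phi_u_const (x : Cn R k) : polydisc x -> phi_u u x = phi_u u 0.
Proof.
move=> /polydisc_gap[sig sig0 hx].
pose N := (Num.bound (4 / sig)).+1.
have N0 : 0 < N%:R :> R by rewrite ltr0n.
have sigN : N%:R^-1 <= sig / 4.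
  rewrite -[leRHS]invrK lef_pV2 ?posrE ?invr_gt0 ?divr_gt0// invf_div.
  apply: le_trans (ltW (archi_boundP _)) _; first by rewrite divr_ge0// ltW.
  by rewrite ler_nat.
have x1 j : absC (x ord0 j) <= 1 by apply: le_trans (hx j) _; lra.
pose y i : Cn R k := (i%:R / N%:R : R)%:C%C *: x.
have yabs i j : (i <= N)%N -> absC (y i ord0 j) <= 1 - sig.
  move=> iN; rewrite mxE absCM absC_real ger0_norm ?divr_ge0//.
  apply: le_trans (hx j); rewrite ler_piMl ?absC_ge0// ler_pdivrMr// mul1r.
  by rewrite ler_nat.
have ydiff i j : absC (y i.+1 ord0 j - y i ord0 j) <= sig / 4.
  rewrite !mxE -mulrBl -rmorphB -mulrBl -natr1 addrAC subrr add0r mul1r.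
  rewrite absCM absC_real gtr0_norm ?invr_gt0//; apply: le_trans sigN.
  by rewrite ler_piMr ?invr_ge0// ltW.
have yE i : (i <= N)%N -> phi_u u (y i) = phi_u u 0.
  elim: i => [_|i IH iN]; first by rewrite /y mul0r scale0r.
  apply: (etrans _ (IH (ltnW iN))); apply/eqP; rewrite eq_le; apply/andP; split.
    by apply: (phi_u_le sig0) => j; [apply: yabs; exact: ltnW | exact: ydiff].
  apply: (phi_u_le sig0) => j; first exact: yabs.
  by rewrite -absCN opprB; exact: ydiff.
have := yE N (leqnn N); have -> // : y N = x.
by rewrite /y divff ?gt_eqF// scale1r.
Qed.

End SubMeanValue.

(* n = k + m with 1 <= k < n, i.e. 1 <= k and 1 <= m *)
Theorem theorem4p2 (R : realType) (k m : nat) :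
  (0 < k)%N -> (0 < m)%N ->
  forall u : Cn R (k + m) -> \bar R,
    psh_polydisc u ->
    (forall z, polydisc z -> (u z <= 0)%E) ->
    exists c : \bar R, forall z' : Cn R k, polydisc z' -> phi_u u z' = c.
Proof.
move=> _ _ u [_ _ _ u_submean] u_le0; exists (phi_u u 0) => z' hz'.
exact: phi_u_const.
Qed.
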